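(* Let $g=(R,\vec b)\in\mathrm{SE}(3)$. The discrete Marsden–Weinstein form $\Omega^{\mathsf{MW}}$ is a pre-symplectic $2$-form on $\mathsf M_g$, i.e. a closed differential $2$-form on $\mathsf M_g$.
   Context: Fix an integer $N\ge3$. An element $g=(R,\vec b)\in\mathrm{SE}(3)$ acts on $\mathbb R^3$ by $g(\vec x)=R\vec x+\vec b$. $\mathsf M_g$ is the space of maps $\gamma:\mathbb Z\to\mathbb R^3$, $i\mapsto\vec\gamma_i$, with $\vec\gamma_{i+N}=g(\vec\gamma_i)$ and $\vec\gamma_{i+1}\neq\vec\gamma_i$ for all $i\in\mathbb Z$; it is parametrized by the vertices $(\vec\gamma_1,\dots,\vec\gamma_N)$, an open subset of $(\mathbb R^3)^N$. Tangent vectors $X\in T_\gamma\mathsf M_g$ are maps $X:\mathbb Z\to\mathbb R^3$ with $X_{i+N}=R\,X_i$. With $\vec e_i=\vec\gamma_{i+1}-\vec\gamma_i$ and the linear interpolation $X_i(s)=(1-s)X_i+sX_{i+1}$, $s\in[0,1]$, the discrete Marsden–Weinstein form is $$\Omega^{\mathsf{MW}}_\gamma(X,Y)=\sum_{i=1}^N\int_0^1\det\big(X_i(s),Y_i(s),\vec e_i\big)\,ds .$$ *)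

(* Defs.v *)
From HB Require Import structures.
From mathcomp Require Import all_boot all_order all_algebra sesquilinear.
From mathcomp Require Import all_classical all_reals all_analysis.

Set Implicit Arguments.
Unset Strict Implicit.
Unset Printing Implicit Defensive.

Import Order.TTheory GRing.Theory Num.Theory.
Import numFieldNormedType.Exports.

Local Open Scope classical_set_scope.
Local Open Scope ring_scope.

Record SE3 (R : realType) := MkSE3 {
  rot : 'M[R]_3;
  trans : 'cV[R]_3;
  rot_orthogonal : rot *m rot^T = 1%:M;
  rot_det : \det rot = 1 }.

Definition act (R : realType) (g : SE3 R) (x : 'cV[R]_3) : 'cV[R]_3 :=
  rot g *m x + trans g.

Definition act_inv (R : realType) (g : SE3 R) (x : 'cV[R]_3) : 'cV[R]_3 :=
  (rot g)^T *m (x - trans g).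

Definition linear_part (R : realType) (g : SE3 R) : SE3 R :=
  MkSE3 0 (rot_orthogonal g) (rot_det g).

Definition curves (R : realType) (N : nat) (g : SE3 R) : set (int -> 'cV[R]_3) :=
  [set c | (forall i, c (i + N%:Z) = act g (c i)) /\
           (forall i, c (i + 1) != c i)].

(* [T_c (curves N g)]; it does not depend on the base point [c] *)
Definition tangent (R : realType) (N : nat) (g : SE3 R) : set (int -> 'cV[R]_3) :=
  [set X | forall i, X (i + N%:Z) = rot g *m X i].

Definition det3 (R : realType) (a b c : 'cV[R]_3) : R :=
  \det (row_mx (row_mx a b) c : 'M[R]_3).

Definition edge (R : realType) (c : int -> 'cV[R]_3) (i : int) : 'cV[R]_3 :=
  c (i + 1) - c i.

Definition interp (R : realType) (X : int -> 'cV[R]_3) (i : int) (s : R) :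
    'cV[R]_3 :=
  (1 - s) *: X i + s *: X (i + 1).

Definition OmegaMW (R : realType) (N : nat) (c X Y : int -> 'cV[R]_3) : R :=
  \sum_(1 <= i < N.+1)
    \int[lebesgue_measure]_(s in `[0, 1])
      det3 (interp X i%:Z s) (interp Y i%:Z s) (edge c i%:Z).

(* column [j : 'I_N] is the vertex of index [j + 1] *)
Definition vertices (R : realType) (N : nat) (c : int -> 'cV[R]_3) :
    'M[R]_(3, N) :=
  \matrix_(a < 3, j < N) c (j : nat).+1%:Z a 0.

Definition act_iter (R : realType) (g : SE3 R) (k : int) :
    'cV[R]_3 -> 'cV[R]_3 :=
  match k with
  | Posz n => iter n (act g)
  | Negz n => iter n.+1 (act_inv g)
  end.

(* the inverse of [vertices]: writing [i - 1 = k N + r] with [0 <= r < N], the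
   vertex of index [i] is [g^k] applied to the vertex of index [r + 1] *)
Definition unroll (R : realType) (N : nat) (g : SE3 R) (p : 'M[R]_(3, N))
    (i : int) : 'cV[R]_3 :=
  act_iter g ((i - 1) %/ N%:Z)%Z
    (oapp (fun j : 'I_N => col j p) 0 (insub `|((i - 1) %% N%:Z)%Z|%N)).

Definition chart (R : realType) (N : nat) (g : SE3 R) : set 'M[R]_(3, N) :=
  @vertices R N @` curves N g.
Arguments chart {R} N g.

(* The coordinate expression of a field of bilinear forms on [curves N g].
   Moving the vertices along [X] moves the curve along [unroll (linear_part g) X],
   see [unroll_affine] below. *)
Definition in_chart (R : realType) (N : nat) (g : SE3 R)
    (w : (int -> 'cV[R]_3) -> (int -> 'cV[R]_3) -> (int -> 'cV[R]_3) -> R)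
    (p X Y : 'M[R]_(3, N)) : R :=
  w (unroll g p) (unroll (linear_part g) X) (unroll (linear_part g) Y).

Fixpoint Ck_on (R : realType) (V : normedModType R) (k : nat) (U : set V)
    (f : V -> R) : Prop :=
  match k with
  | 0 => forall p, U p -> {for p, continuous f}
  | k'.+1 => (forall p, U p -> differentiable f p) /\
             (forall v, Ck_on k' U ('D_v f))
  end.

Definition smooth_on (R : realType) (V : normedModType R) (U : set V)
    (f : V -> R) : Prop :=
  forall k, Ck_on k U f.

(* Smoothness is tested on constant vector fields, which is enough in a
   finite-dimensional [V]. *)
Definition differential_2form (R : realType) (V : normedModType R) (U : set V)
    (w : V -> V -> V -> R) : Prop :=
  [/\ forall p, U p -> bilinear_for *%R *%R (w p),
      forall p, U p -> forall X, w p X X = 0 &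
      forall X Y, smooth_on U (fun p => w p X Y)].

(* the exterior derivative, on constant vector fields (whose brackets vanish) *)
Definition ext_derivative (R : realType) (V : normedModType R)
    (w : V -> V -> V -> R) (p X Y Z : V) : R :=
  'D_X (fun q => w q Y Z) p - 'D_Y (fun q => w q X Z) p
  + 'D_Z (fun q => w q X Y) p.

Definition closed_2form (R : realType) (V : normedModType R) (U : set V)
    (w : V -> V -> V -> R) : Prop :=
  forall p, U p -> forall X Y Z, ext_derivative w p X Y Z = 0.

Definition presymplectic_form (R : realType) (V : normedModType R) (U : set V)
    (w : V -> V -> V -> R) : Prop :=
  differential_2form U w /\ closed_2form U w.

Section ChartFacts.
Context {R : realType}.
Implicit Types (g : SE3 R) (x : 'cV[R]_3).

Lemma actK g : cancel (act g) (act_inv g).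
Proof.
move=> x; rewrite /act_inv /act addrK mulmxA.
by rewrite (mulmx1C (rot_orthogonal g)) mul1mx.
Qed.

Lemma act_invK g : cancel (act_inv g) (act g).
Proof.
by move=> x; rewrite /act_inv /act mulmxA rot_orthogonal mul1mx subrK.
Qed.

Lemma act_iterS g (k : int) x : act_iter g (k + 1) x = act g (act_iter g k x).
Proof.
case: k => [n|[|n]].
- by rewrite (_ : n%:Z + 1 = n.+1%:Z) ?[in LHS]/= // -addn1.
- by rewrite /= act_invK.
- rewrite (_ : Negz n.+1 + 1 = Negz n); first by rewrite /= act_invK.
  by rewrite !NegzE -[n.+2]addn1 PoszD opprD subrK.
Qed.

Lemma linear_actE g x : act (linear_part g) x = rot g *m x.
Proof. by rewrite /act /= addr0. Qed.

Variables (N : nat) (N_gt0 : (0 < N)%N).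

Let N0 : N%:Z != 0. Proof. by rewrite eqz_nat -lt0n. Qed.

Lemma unrollD g (p : 'M[R]_(3, N)) (i : int) :
  unroll g p (i + N%:Z) = act g (unroll g p i).
Proof.
rewrite /unroll -act_iterS [i + _]addrC -addrA modzDl.
by rewrite (@divzDl N%:Z (i - 1)) ?dvdzz// divzz N0 [_ + 1]addrC.
Qed.

Lemma unrollE g (p : 'M[R]_(3, N)) (j : 'I_N) :
  unroll g p (j : nat).+1%:Z = col j p.
Proof.
rewrite /unroll (_ : (j : nat).+1%:Z - 1 = j%:Z); last first.
  by rewrite -addn1 PoszD addrK.
by rewrite modz_nat divz_nat modn_small// divn_small//= valK.
Qed.

Lemma vertices_unroll g : cancel (@unroll R N g) (@vertices R N).
Proof. by move=> p; apply/matrixP => a j; rewrite mxE unrollE mxE. Qed.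

Lemma unroll_vertices g (c : int -> 'cV[R]_3) :
  (forall i, c (i + N%:Z) = act g (c i)) -> unroll g (vertices N c) = c.
Proof.
move=> cN.
have cNk n i : c (i + (n * N)%:Z) = iter n (act g) (c i).
  elim: n => [|n IH]; first by rewrite mul0n addr0.
  by rewrite mulSn addnC PoszD addrA cN IH.
have cNk' n i : c (i - (n * N)%:Z) = iter n (act_inv g) (c i).
  elim: n i => [|n IH] i; first by rewrite mul0n subr0.
  by rewrite iterS -IH -[LHS](actK g) -cN mulSn PoszD opprD addrA addrAC subrK.
apply/funext => i; rewrite /unroll.
have m0 : 0 <= ((i - 1) %% N%:Z)%Z by rewrite modz_ge0.
have mN : (`|((i - 1) %% N%:Z)%Z| < N)%N.
  by rewrite -ltz_nat gez0_abs// ltz_pmod// ltz_nat.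
rewrite insubT//= (_ : col _ _ = c (((i - 1) %% N%:Z)%Z + 1)); last first.
  apply/matrixP => a b; rewrite !mxE ord1 /=; congr (c _ a 0).
  by rewrite -[in RHS](gez0_abs m0) -PoszD addn1.
have ->: c i = c (((i - 1) %% N%:Z)%Z + 1 + ((i - 1) %/ N%:Z)%Z * N%:Z).
  by congr c; rewrite addrAC [_ + _ * _]addrC -divz_eq subrK.
case: (_ %/ _)%Z => n.
  by rewrite -PoszM cNk.
by rewrite NegzE mulNr -PoszM cNk'.
Qed.

Lemma unroll_affine g (p X : 'M[R]_(3, N)) (t : R) (i : int) :
  unroll g (p + t *: X) i = unroll g p i + t *: unroll (linear_part g) X i.
Proof.
have itD n x y : iter n (act g) (x + t *: y) =
    iter n (act g) x + t *: iter n (act (linear_part g)) y.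
  elim: n => // n IH /=; rewrite IH linear_actE /act mulmxDr -scalemxAr.
  by rewrite addrAC.
have itD' n x y : iter n (act_inv g) (x + t *: y) =
    iter n (act_inv g) x + t *: iter n (act_inv (linear_part g)) y.
  elim: n => // n IH /=; rewrite IH /act_inv /= subr0.
  by rewrite addrAC mulmxDr -scalemxAr.
have act_iterD k x y : act_iter g k (x + t *: y) =
    act_iter g k x + t *: act_iter (linear_part g) k y.
  by case: k => n; [exact: itD | exact: (itD' n.+1)].
rewrite /unroll -act_iterD; congr act_iter.
case: insubP => [j _ _|_] /=; last by rewrite scaler0 addr0.
by rewrite linearD linearZ.
Qed.

Lemma unroll_tangent g (X : 'M[R]_(3, N)) :
  tangent N g (unroll (linear_part g) X).
Proof. by move=> i; rewrite unrollD linear_actE. Qed.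

Lemma unroll_vertices_tangent g (X : int -> 'cV[R]_3) :
  tangent N g X -> unroll (linear_part g) (vertices N X) = X.
Proof. by move=> XT; apply: unroll_vertices => i; rewrite linear_actE. Qed.

Lemma chartE g (p : 'M[R]_(3, N)) : chart N g p <-> curves N g (unroll g p).
Proof.
split=> [[c cg <-]|up]; first by rewrite unroll_vertices//; case: cg.
by exists (unroll g p) => //; exact: vertices_unroll.
Qed.

Lemma open_chart g : open (chart N g).
Proof.
have lin_cont (T : topologicalType) (M : 'M[R]_3) (b : 'cV[R]_3) (x : T -> 'cV[R]_3) :
    (forall a, continuous (fun p => x p a 0)) ->
    forall a, continuous (fun p => (M *m x p + b) a 0).
  move=> xc a p.
  rewrite (_ : (fun p => _) = (fun p => \sum_k M a k * x p k 0 + b a 0)); last first.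
    by apply/funext => q; rewrite !mxE.
  apply: cvgD; last exact: cvg_cst.
  by apply: cvg_big => [|k _]; [exact: add_continuous|apply: cvgM; [exact: cvg_cst|exact: xc]].
have inv_cont (T : topologicalType) (x : T -> 'cV[R]_3) :
    (forall a, continuous (fun p => x p a 0)) ->
    forall a, continuous (fun p => act_inv g (x p) a 0).
  by move=> xc a; rewrite /act_inv; under eq_fun do rewrite mulmxBr; exact: lin_cont.
have unroll_cont i a : continuous (fun p : 'M[R]_(3, N) => unroll g p i a 0).
  rewrite /unroll; pose y (p : 'M[R]_(3, N)) :=
    oapp (fun j : 'I_N => col j p) 0 (insub `|((i - 1) %% N%:Z)%Z|%N).
  rewrite -[X in continuous X]/(fun p => act_iter g _ (y p) a 0).
  have yc b : continuous (fun p => y p b 0).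
    rewrite /y; case: insub => [j|] /=; last exact: cst_continuous.
    by under eq_fun do rewrite mxE; exact: coord_continuous.
  case: (_ %/ _)%Z => n /=; elim: n a => [|n IH] a //=.
  - exact: lin_cont.
  - exact: inv_cont.
  - exact: inv_cont.
have chartP p : chart N g p <->
    forall j : 'I_N, unroll g p ((j : nat).+1%:Z + 1) != unroll g p (j : nat).+1%:Z.
  rewrite chartE; split=> [[_ cn] j|cn]; first exact: cn.
  split; first exact: unrollD.
  have unroll_ne i : (unroll g p (i + N%:Z + 1) != unroll g p (i + N%:Z)) =
      (unroll g p (i + 1) != unroll g p i).
    by rewrite (addrAC i) !unrollD (can_eq (actK g)).
  have unroll_nek i (n : nat) :
      (unroll g p (i + (n * N)%:Z + 1) != unroll g p (i + (n * N)%:Z)) =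
      (unroll g p (i + 1) != unroll g p i).
    elim: n => [|n IH]; first by rewrite mul0n addr0.
    by rewrite mulSn addnC PoszD addrA (unroll_ne (i + (n * N)%:Z)).
  move=> i.
  have m0 : 0 <= ((i - 1) %% N%:Z)%Z by rewrite modz_ge0.
  have mN : (`|((i - 1) %% N%:Z)%Z| < N)%N.
    by rewrite -ltz_nat gez0_abs// ltz_pmod// ltz_nat.
  have := cn (Ordinal mN).
  rewrite (_ : (Ordinal mN).+1%:Z = ((i - 1) %% N%:Z)%Z + 1); last first.
    by rewrite -[in RHS](gez0_abs m0) -PoszD addn1.
  have : i = ((i - 1) %% N%:Z)%Z + 1 + ((i - 1) %/ N%:Z)%Z * N%:Z.
    by rewrite addrAC [_ + _ * _]addrC -divz_eq subrK.
  move: ((i - 1) %% N%:Z)%Z ((i - 1) %/ N%:Z)%Z => r k.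
  case: k => n ei; first by rewrite ei -PoszM (unroll_nek (r + 1) n).
  have -> : r + 1 = i + (n.+1 * N)%:Z.
    by rewrite ei NegzE mulNr -PoszM subrK.
  by rewrite (unroll_nek i n.+1).
rewrite openE => p /chartP cn; rewrite /interior.
have : \forall q \near p, forall j : 'I_N,
    unroll g q ((j : nat).+1%:Z + 1) != unroll g q (j : nat).+1%:Z.
  apply: (@filter_forall _ _ _ (nbhs p)) => j.
  have [a ha] : exists a,
      unroll g p ((j : nat).+1%:Z + 1) a 0 - unroll g p (j : nat).+1%:Z a 0 != 0.
    apply: contrapT => /forallNP h; move/eqP: (cn j); apply.
    by apply/matrixP => a b; rewrite ord1; apply/eqP/negPn; rewrite -subr_eq0; exact/negP/h.
  have dc : continuous (fun q : 'M[R]_(3, N) =>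
      unroll g q ((j : nat).+1%:Z + 1) a 0 - unroll g q (j : nat).+1%:Z a 0).
    by move=> q; exact: (continuousB (unroll_cont _ a q) (unroll_cont _ a q)).
  have ne0 : nbhs (unroll g p ((j : nat).+1%:Z + 1) a 0
      - unroll g p (j : nat).+1%:Z a 0) [set x | x != 0].
    by apply: open_nbhs_nbhs; split => //; exact: open_neq.
  apply: (@filterS _ (nbhs p) _ _ _ _ (dc p _ ne0)) => q.
  by apply: contra_neq => /= ->; rewrite subrr.
exact: (@filterS _ (nbhs p) _ _ _ (fun q => (chartP q).2)).
Qed.

End ChartFacts.

(* Main.v *)
From HB Require Import structures.
Require Import Defs.
From mathcomp Require Import all_boot all_order all_algebra.
From mathcomp Require Import sesquilinear ring.
From mathcomp Require Import all_classical all_reals all_analysis.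

(** Why the form is closed.  The edge vectors are affine in the vertices and a
    tangent vector moves the curve by itself, so, for constant fields X, Y, Z on
    the chart, the function q |-> Omega_q(X, Y) is affine, and its slope in the
    direction Z is Omega with the edge vectors of the curve replaced by those
    of Z ([in_chart_OmegaMW_affine]).  An affine function of the vertices is
    smooth ([smooth_affine]), which settles everything but closedness, because
    bilinearity and alternation come from the determinant.

    The exterior derivative on X, Y, Z is then the cyclic sum of these slopes.
    On the i-th edge the three integrands add up to
      det (X', Y, Z) + det (X, Y', Z) + det (X, Y, Z') = (det (X, Y, Z))',
    the derivative being taken in the interpolation parameter s.  The sum is
    therefore a boundary term: it telescopes along the curve to
    det (X_(N+1), Y_(N+1), Z_(N+1)) - det (X_1, Y_1, Z_1) ([OmegaMW_cyclic]).
    Since tangent vectors are carried over one period by the rotation of the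
    monodromy, which has determinant 1, the difference vanishes
    ([OmegaMW_cyclic_tangent]).

    The integrals are eliminated at the outset: each integrand is quadratic in
    s, so the integral is an explicit combination of determinants at the two
    ends of the edge ([OmegaMWE]), and the identities above become polynomial
    identities in the coordinates. *)

Set Implicit Arguments.
Unset Strict Implicit.
Unset Printing Implicit Defensive.

Import Order.TTheory GRing.Theory Num.Theory.
Import numFieldNormedType.Exports.

Local Open Scope classical_set_scope.
Local Open Scope ring_scope.

Lemma det_mx33 (R : comNzRingType) (M : 'M[R]_3) :
  \det M =
    M 0 0 * (M 1 1 * M 2 2 - M 2 1 * M 1 2)
  - M 1 0 * (M 0 1 * M 2 2 - M 2 1 * M 0 2)
  + M 2 0 * (M 0 1 * M 1 2 - M 1 1 * M 0 2).
Proof.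
(* Indexing the entries by natural numbers lets the ordinals produced by the
   Laplace expansion evaluate to numerals. *)
pose m (i j : nat) := M (inord i) (inord j).
have ME i j : M i j = m i j by rewrite /m !inord_val.
rewrite (expand_det_col _ 0) !big_ord_recl big_ord0 /cofactor.
rewrite !(expand_det_col _ 0) !big_ord_recl !big_ord0 /cofactor !det_mx11 !mxE.
by rewrite !ME /=; ring.
Qed.

Lemma det3E (R : realType) (a b c : 'cV[R]_3) :
  det3 a b c =
    a 0 0 * (b 1 0 * c 2 0 - b 2 0 * c 1 0)
  - a 1 0 * (b 0 0 * c 2 0 - b 2 0 * c 0 0)
  + a 2 0 * (b 0 0 * c 1 0 - b 1 0 * c 0 0).
Proof.
have e0 : (0 : 'I_3) = lshift 1 (lshift 1 (0 : 'I_1)) by exact: val_inj.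
have e1 : (1 : 'I_3) = lshift 1 (rshift 1 (0 : 'I_1)) by exact: val_inj.
have e2 : (2 : 'I_3) = rshift 2 (0 : 'I_1) by exact: val_inj.
pose M : 'M[R]_3 := row_mx (row_mx a b) c.
have Ma i : M i 0 = a i 0.
  by rewrite e0; apply: etrans (row_mxEl _ _ _ _) _; exact: row_mxEl.
have Mb i : M i 1 = b i 0.
  by rewrite e1; apply: etrans (row_mxEl _ _ _ _) _; exact: row_mxEr.
have Mc i : M i 2 = c i 0 by rewrite e2; exact: row_mxEr.
by rewrite /det3 -/M det_mx33 !(Ma, Mb, Mc).
Qed.

Lemma det3_mulmx (R : realType) (M : 'M[R]_3) (a b c : 'cV[R]_3) :
  det3 (M *m a) (M *m b) (M *m c) = \det M * det3 a b c.
Proof. by rewrite /det3 -!mul_mx_row det_mulmx. Qed.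

Lemma Rintegral01_quadratic (R : realType) (a b c : R) :
  \int[lebesgue_measure]_(s in `[0, 1]) (a + b * s + c * s ^+ 2) =
  a + b / 2 + c / 3.
Proof.
pose F (s : R) := a * s + b / 2 * s ^+ 2 + c / 3 * s ^+ 3.
have dF (s : R) : is_derive s 1 F (a + b * s + c * s ^+ 2).
  rewrite /F; apply: is_derive_eq; rewrite /GRing.scale /=.
  by field.
have cF (s : R) : {for s, continuous F}.
  by apply/differentiable_continuous/derivable1_diffP; case: (dF s).
rewrite /Rintegral (@continuous_FTC2 _ _ F)//.
- by rewrite /F /=; field.
- apply: continuous_subspaceT => s.
  apply: cvgD; [apply: cvgD; [exact: cvg_cst|] |].
  + by apply: cvgM; [exact: cvg_cst|exact: cvg_id].
  + by apply: cvgM; [exact: cvg_cst|exact: exprn_continuous].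
- split => [s _||]; first by case: (dF s).
  + exact: cvg_at_right_filter (cF 0).
  + exact: cvg_at_left_filter (cF 1).
- by move=> s _; rewrite derive1E; case: (dF s) => _ ->.
Qed.

(** The integral over [0, 1] of det (x(s), y(s), e) for the linear interpolations
    x(s) from x0 to x1 and y(s) from y0 to y1; the weights are the integrals of
    (1 - s)^2, s (1 - s) and s^2, that is 1/3, 1/6 and 1/3. *)
Definition segment_form (R : realType) (x0 x1 y0 y1 e : 'cV[R]_3) : R :=
  (2 * det3 x0 y0 e + det3 x0 y1 e + det3 x1 y0 e + 2 * det3 x1 y1 e) / 6.

Lemma OmegaMWE (R : realType) (N : nat) (c X Y : int -> 'cV[R]_3) :
  OmegaMW N c X Y = \sum_(1 <= i < N.+1)
    segment_form (X i%:Z) (X (i%:Z + 1)) (Y i%:Z) (Y (i%:Z + 1)) (edge c i%:Z).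
Proof.
apply: eq_bigr => i _; rewrite /interp /segment_form.
move: (X _) (X (_ + 1)) (Y _) (Y (_ + 1)) (edge _ _) => x0 x1 y0 y1 e.
(* a, b, d are the coefficients of the integrand as a polynomial in s, read off
   from x(s) = x0 + s (x1 - x0) and y(s) = y0 + s (y1 - y0). *)
pose a := det3 x0 y0 e; pose b := det3 x0 (y1 - y0) e + det3 (x1 - x0) y0 e.
pose d := det3 (x1 - x0) (y1 - y0) e.
transitivity (\int[lebesgue_measure]_(s in `[0, 1]) (a + b * s + d * s ^+ 2)).
  by apply: eq_Rintegral => s _; rewrite /a /b /d !det3E !mxE; ring.
by rewrite Rintegral01_quadratic /a /b /d !det3E !mxE; field.
Qed.

(** The curve enters only through its edge vectors, which are linear in it, so a
    tangent vector Z can take the place of the curve: this is the slope of the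
    form in the direction Z. *)
Lemma OmegaMW_affine_curve (R : realType) (N : nat)
    (c Z X Y : int -> 'cV[R]_3) (t : R) :
  OmegaMW N (c + t *: Z) X Y = OmegaMW N c X Y + t * OmegaMW N Z X Y.
Proof.
rewrite !OmegaMWE mulr_sumr -big_split; apply: eq_bigr => i _ /=.
by rewrite /segment_form /edge !det3E !fctE !mxE; field.
Qed.

Lemma OmegaMW_affine_left (R : realType) (N : nat)
    (c X X' Y : int -> 'cV[R]_3) (t : R) :
  OmegaMW N c (X + t *: X') Y = OmegaMW N c X Y + t * OmegaMW N c X' Y.
Proof.
rewrite !OmegaMWE mulr_sumr -big_split; apply: eq_bigr => i _ /=.
by rewrite /segment_form !det3E !fctE !mxE; field.
Qed.

Lemma OmegaMWC (R : realType) (N : nat) (c X Y : int -> 'cV[R]_3) :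
  OmegaMW N c Y X = - OmegaMW N c X Y.
Proof.
rewrite !OmegaMWE -sumrN; apply: eq_bigr => i _.
by rewrite /segment_form !det3E; field.
Qed.

(** The product rule for the determinant, integrated over each edge and summed:
    only the two ends of the range of summation remain. *)
Lemma OmegaMW_cyclic (R : realType) (N : nat) (X Y Z : int -> 'cV[R]_3) :
  OmegaMW N X Y Z - OmegaMW N Y X Z + OmegaMW N Z X Y =
  det3 (X (N.+1)%:Z) (Y (N.+1)%:Z) (Z (N.+1)%:Z) - det3 (X 1) (Y 1) (Z 1).
Proof.
rewrite !OmegaMWE -sumrB -big_split /=.
rewrite -(@telescope_sumr _ 1 N.+1 (fun i => det3 (X i%:Z) (Y i%:Z) (Z i%:Z)))//.
apply: eq_bigr => i _.
rewrite (_ : i.+1%:Z = i%:Z + 1); last by rewrite -addn1 PoszD.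
by rewrite /segment_form /edge !det3E !mxE; field.
Qed.

Lemma OmegaMW_cyclic_tangent (R : realType) (N : nat) (g : SE3 R)
    (X Y Z : int -> 'cV[R]_3) :
  tangent N g X -> tangent N g Y -> tangent N g Z ->
  OmegaMW N X Y Z - OmegaMW N Y X Z + OmegaMW N Z X Y = 0.
Proof.
move=> tX tY tZ; rewrite OmegaMW_cyclic.
have -> : N.+1%:Z = 1 + N%:Z by rewrite -PoszD add1n.
by rewrite tX tY tZ det3_mulmx rot_det mul1r subrr.
Qed.

(** An affine function is handled through its slope [L], given by the identity
    [fL] alone: linearity of [L] follows from it, and so does continuity since
    the space of matrices has finite dimension. *)
Section AffineFunctions.
Context (R : realType) (m n : nat).
Variables (f L : 'M[R]_(m, n) -> R).
Hypothesis fL : forall p t Z, f (p + t *: Z) = f p + t * L Z.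

Lemma affine_slope_linear : linear L.
Proof.
(* Both sides are the increment of f from 0 to t Z + Z', taken in one step or in
   two. *)
move=> t Z Z'; apply: (addrI (f 0)).
have := fL (0 + t *: Z) 1 Z'; rewrite scale1r mul1r -addrA !fL.
by have := fL 0 1 (t *: Z + Z'); rewrite scale1r mul1r => -> ->; rewrite addrA.
Qed.

HB.instance Definition _ :=
  @GRing.isLinear.Build R 'M[R]_(m, n) R *:%R L affine_slope_linear.

Lemma affine_slope_continuous : continuous L.
Proof.
have LE p : L p = \sum_i \sum_j p i j * L (delta_mx i j).
  rewrite [in LHS](matrix_sum_delta p) linear_sum; apply: eq_bigr => i _.
  by rewrite linear_sum; apply: eq_bigr => j _; rewrite linearZ.
rewrite (_ : L = fun p => \sum_i \sum_j p i j * L (delta_mx i j));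
  last exact/funext/LE.
have sum_cont (I : finType) (h : I -> 'M[R]_(m, n) -> R) :
    (forall i, continuous (h i)) -> continuous (fun p => \sum_i h i p).
  move=> hc p; apply: (@cvg_big _ _ _ _ _ _ _ (nbhs p)) => [|i _].
    exact: add_continuous.
  exact: hc.
apply: (sum_cont) => i; apply: sum_cont => j p.
exact: (continuousM (@coord_continuous R m n i j p)
  (@cst_continuous _ _ (L (delta_mx i j)) p)).
Qed.

Lemma affine_differential p : is_diff p f L.
Proof.
have -> : f = cst (f 0) + L.
  by apply/funext => q; have := fL 0 1 q; rewrite scale1r add0r mul1r.
have dL : is_diff p L L.
  apply: DiffDef; first exact/linear_differentiable/affine_slope_continuous.
  exact/diff_lin/affine_slope_continuous.
by apply: is_diff_eq; rewrite add0r.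
Qed.

Lemma derive_affine p Z : 'D_Z f p = L Z.
Proof. by have fp := affine_differential p; rewrite deriveE // diff_val. Qed.

Lemma smooth_affine (U : set 'M[R]_(m, n)) : smooth_on U f.
Proof.
have smooth_cst (a : R) k : Ck_on k U (cst a : 'M[R]_(m, n) -> R).
  elim: k a => [|k IH] a /=; first by move=> p _; exact: cst_continuous.
  split=> [p _|v]; first exact: differentiable_cst.
  by rewrite (_ : 'D_v _ = cst 0) //; apply/funext => p; rewrite derive_cst.
have df p : differentiable f p by have [] := affine_differential p.
case=> [|k] /=; first by move=> p _; exact/differentiable_continuous.
(* After one derivative only constants are left. *)
split=> [//|v].
by rewrite (_ : 'D_v f = cst (L v)) //; apply/funext => p; exact: derive_affine.
Qed.

End AffineFunctions.

Lemma unroll_affine_fun (R : realType) (N : nat) (g : SE3 R)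
    (p X : 'M[R]_(3, N)) (t : R) :
  unroll g (p + t *: X) = unroll g p + t *: unroll (linear_part g) X.
Proof. by apply/funext => i; rewrite unroll_affine. Qed.

(** The slope is again a coordinate expression of the form, for the linear part of
    g: the displacement of a curve is equivariant under the rotation alone. *)
Lemma in_chart_OmegaMW_affine (R : realType) (N : nat) (g : SE3 R)
    (X Y p : 'M[R]_(3, N)) (t : R) (Z : 'M[R]_(3, N)) :
  in_chart g (@OmegaMW R N) (p + t *: Z) X Y =
  in_chart g (@OmegaMW R N) p X Y
  + t * in_chart (linear_part g) (@OmegaMW R N) Z X Y.
Proof. by rewrite /in_chart unroll_affine_fun OmegaMW_affine_curve. Qed.

Theorem proposition4p2 (R : realType) (N : nat) (hN : (3 <= N)%N) (g : SE3 R) :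
  presymplectic_form (chart N g) (in_chart g (@OmegaMW R N)).
Proof.
pose w : 'M[R]_(3, N) -> _ := in_chart g (@OmegaMW R N); rewrite -/w.
pose slope X Y (Z : 'M[R]_(3, N)) :=
  in_chart (linear_part g) (@OmegaMW R N) Z X Y.
have w_affine X Y p t Z : w (p + t *: Z) X Y = w p X Y + t * slope X Y Z.
  exact: in_chart_OmegaMW_affine.
have wC p X Y : w p Y X = - w p X Y by exact: OmegaMWC.
have wD p t X X' Y : w p (t *: X + X') Y = t * w p X Y + w p X' Y.
  rewrite addrC [RHS]addrC /w /in_chart.
  by rewrite unroll_affine_fun OmegaMW_affine_left.
split; [split|].
- move=> p _; split=> [Y|X] t Z Z' /=; first exact: wD.
  by rewrite ![w p X _]wC wD opprD mulrN.
- move=> p _ X; apply/eqP.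
  by rewrite -[_ == 0](@mulrn_eq0 _ _ 2) mulr2n {2}wC subrr.
- move=> X Y; exact: (@smooth_affine _ _ _ _ (slope X Y) (w_affine X Y)).
- move=> p _ X Y Z; rewrite /ext_derivative.
  have dw U V W : 'D_W (fun q => w q U V) p = slope U V W.
    exact: derive_affine (w_affine U V) p W.
  transitivity (slope Y Z X - slope X Z Y + slope X Y Z).
    by congr (_ - _ + _); exact: dw.
  have N_gt0 : (0 < N)%N by exact: leq_trans hN.
  apply: (@OmegaMW_cyclic_tangent _ _ g); exact: unroll_tangent.
Qed.
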